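(* For each non-negative integer $n$, \[ \sum_{k=0}^n (-1)^{k} \binom {n+k}{k} F_{n+1-k} = 1 - 2\sum_{k=0}^{n-1} (-1)^{k} \binom {2k+1}{k} \qquad\text{and}\qquad \sum_{k=0}^n (-1)^{k} \binom {n+k}{k} L_{n+1-k} = 1. \]
   Context: $F_j$ and $L_j$ denote the Fibonacci and Lucas numbers: $F_0=0,F_1=1$, $L_0=2,L_1=1$, both satisfying $X_j=X_{j-1}+X_{j-2}$. *)

(* Defs.v *)
From mathcomp Require Import all_boot all_order all_algebra.

Set Implicit Arguments.
Unset Strict Implicit.
Unset Printing Implicit Defensive.

Fixpoint fib (j : nat) : nat :=
  match j with
  | 0 => 0
  | i.+1 => match i with 0 => 1 | h.+1 => fib i + fib h end
  end.

Fixpoint lucas (j : nat) : nat :=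
  match j with
  | 0 => 2
  | i.+1 => match i with 0 => 1 | h.+1 => lucas i + lucas h end
  end.

(* Main.v *)
Require Import Defs.
From mathcomp Require Import all_boot all_order all_algebra.
From mathcomp Require Import ring zify.

(** Let S(n) be the sum of (-1)^k C(n+k,k) X_(n+1-k) for k from 0 to n, where
    X is any sequence with X_(j+2) = X_(j+1) + X_j.  By Pascal's rule, the
    partial sums of S(n+1) - S(n) telescope, leaving
    S(n+1) - S(n) = (-1)^n C(2n+1,n) (X_0 - 2 X_1).
    The last factor is 0 for Lucas numbers and -2 for Fibonacci numbers. *)

Import Order.TTheory GRing.Theory Num.Theory.
Local Open Scope ring_scope.

Section FibonacciLike.

Variables (R : comPzRingType) (X : nat -> R).
Hypothesis X_rec : forall j, X j.+2 = X j.+1 + X j.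

Let S n := \sum_(0 <= k < n.+1) (-1) ^+ k * 'C(n + k, k)%:R * X (n + 1 - k).

(** Stopping at a free [m] makes induction possible; [m <= n] keeps the truncated index [n - m]
    exact. *)
Lemma altbin_partial_sum_diff (n m : nat) : (m <= n)%N ->
  \sum_(0 <= k < m.+1) (-1) ^+ k * 'C(n.+1 + k, k)%:R * X (n.+1 + 1 - k)
  - \sum_(0 <= k < m.+1) (-1) ^+ k * 'C(n + k, k)%:R * X (n + 1 - k)
  = (-1) ^+ m * 'C(n.+1 + m, m)%:R * X (n - m).
Proof.
elim: m => [_|m IHm lt_mn].
  by rewrite !big_nat1 !addn0 !bin0 !subn0 !addn1 X_rec; ring.
rewrite big_nat_recr //= [X in _ - X]big_nat_recr //= opprD addrACA.
rewrite IHm; last exact: ltnW.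
have -> : (n.+1 + 1 - m.+1 = (n - m.+1).+2)%N by lia.
have -> : (n + 1 - m.+1 = (n - m.+1).+1)%N by lia.
have -> : (n - m = (n - m.+1).+1)%N by lia.
have -> : 'C(n.+1 + m.+1, m.+1)%:R
        = 'C(n + m.+1, m.+1)%:R + 'C(n.+1 + m, m)%:R :> R.
  by rewrite -natrD !addSn binS addnS.
(* With [p = n - m.+1], both binomials from Pascal's rule multiply [X p.+2 - X p.+1], that is
   [X p]. *)
by rewrite X_rec exprS; ring.
Qed.

Lemma altbin_sumS (n : nat) :
  S n.+1 = S n + (-1) ^+ n * 'C(2 * n + 1, n)%:R * (X 0 - 2 * X 1).
Proof.
(* Taking [m = n] yields the [X 0] part; the leftover term [k = n.+1] of [S n.+1] yields the [X 1]
   part. *)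
have /eqP := altbin_partial_sum_diff n n (leqnn n).
rewrite subr_eq => /eqP sum_n.
rewrite /S big_nat_recr //= sum_n subnn.
have -> : (n.+1 + 1 - n.+1 = 1)%N by lia.
have -> : (n.+1 + n = 2 * n + 1)%N by lia.
have -> : 'C(n.+1 + n.+1, n.+1)%:R = 2 * 'C(2 * n + 1, n)%:R :> R.
  have -> : (n.+1 + n.+1 = (2 * n + 1).+1)%N by lia.
  (* By symmetry the two Pascal summands of the central binomial are equal, hence the factor 2. *)
  rewrite binS -[X in (X + _)%N]bin_sub; last by lia.
  have -> : (2 * n + 1 - n.+1 = n)%N by lia.
  by rewrite addnn -mul2n natrM.
by rewrite exprS; ring.
Qed.

Lemma altbin_sumE (n : nat) :
  S n = X 1 + (X 0 - 2 * X 1)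
              * \sum_(0 <= k < n) (-1) ^+ k * 'C(2 * k + 1, k)%:R.
Proof.
elim: n => [|n IHn]; first by rewrite /S big_nat1 big_geq // bin0; ring.
by rewrite altbin_sumS IHn [in RHS]big_nat_recr //=; ring.
Qed.

End FibonacciLike.

Theorem theorem12 (n : nat) :
  (\sum_(0 <= k < n.+1)
      (-1) ^+ k * ('C(n + k, k))%:Z * (fib (n + 1 - k))%:Z
   = 1 - 2 * (\sum_(0 <= k < n) (-1) ^+ k * ('C(2 * k + 1, k))%:Z))
  /\
  (\sum_(0 <= k < n.+1)
      (-1) ^+ k * ('C(n + k, k))%:Z * (lucas (n + 1 - k))%:Z = 1).
Proof.
have fib_rec j : (fib j.+2)%:Z = (fib j.+1)%:Z + (fib j)%:Z by rewrite -PoszD.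
have lucas_rec j : (lucas j.+2)%:Z = (lucas j.+1)%:Z + (lucas j)%:Z.
  by rewrite -PoszD.
have fibE := altbin_sumE int (fun j => (fib j)%:Z) fib_rec n.
have lucasE := altbin_sumE int (fun j => (lucas j)%:Z) lucas_rec n.
split.
  (* The binomials must be cast by [%:R], as in [altbin_sumE], before [fibE] can match. *)
  under eq_bigr do rewrite -natz.
  under [in RHS]eq_bigr do rewrite -natz.
  by rewrite fibE /=; ring.
under eq_bigr do rewrite -[('C(_, _))%:Z]natz.
by rewrite lucasE /=; ring.
Qed.
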